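(* Let $(V, e)$ be an order unit space and let $u \in S_V$, i.e. $u \in V^+$ with $\|u\| = 1 = \|e - u\|$. Then the following statements are equivalent: (1) $u$ is an order projection in $V$; (2) $[-u, u] \perp_{\infty} [-(e - u), (e - u)]$; (3) $u \perp_{\infty} [-(e - u), (e - u)]$ and $(e - u) \perp_{\infty} [-u, u]$.
   Context: An order unit space $(V,e)$ is a real ordered vector space $V$ with proper positive cone $V^+$ (where $x \le y$ means $y - x \in V^+$), with an order unit $e \in V^+$, $e\neq 0$ (for every $v \in V$ there is $k>0$ with $ke \pm v \in V^+$), such that $V^+$ is Archimedean; it carries the order unit norm $\|v\| = \inf\{k > 0 : ke \pm v \in V^+\}$. Order intervals are $[a,b] = \{v \in V : a \le v \le b\}$. $S_V := \{u \in V^+ : \|u\| = 1 = \|e - u\|\}$. Order unit property (OUP): $u \in V^+$ has the OUP in $V$ if, for every $v \in V$, $\|v\| u \pm v \in V^+$ whenever $\lambda u \pm v \in V^+$ for some real $\lambda > 0$. An element $u \in V^+$ is an order projection if both $u$ and $e - u$ have the OUP in $V$. For elements $x, y$ of a real normed linear space, $x \perp_{\infty} y$ means $\|x + k y\| = \max\{\|x\|, \|k y\|\}$ for all $k \in \mathbb{R}$. For subsets $A,B$, $A \perp_{\infty} B$ means $a \perp_\infty b$ for all $a \in A$, $b \in B$; $x \perp_\infty B$ means $\{x\} \perp_\infty B$. *)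

(* Defs.v *)
From mathcomp Require Import all_boot all_order all_algebra.
From mathcomp Require Import boolp classical_sets reals.
Set Implicit Arguments.
Unset Strict Implicit.
Unset Printing Implicit Defensive.
Import Order.TTheory GRing.Theory Num.Theory.
Local Open Scope classical_set_scope.
Local Open Scope ring_scope.

(* The order of a real ordered vector space is carried by its positive cone,
   a set [C] of vectors. *)
Section OrderUnitSpace.
Context {R : realType} {V : lmodType R}.
Implicit Types (C A B : set V) (e u v w x y a b : V).

Record proper_cone C : Prop := ProperCone {
  cone_zero : C 0;
  cone_add : forall v w, C v -> C w -> C (v + w);
  cone_scale : forall (k : R) v, 0 <= k -> C v -> C (k *: v);
  cone_proper : forall v, C v -> C (- v) -> v = 0 }.

Definition cone_le C v w : Prop := C (w - v).

Definition order_interval C a b : set V :=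
  [set v | cone_le C a v /\ cone_le C v b].

Definition order_unit C e : Prop :=
  forall v, exists k : R, [/\ 0 < k, C (k *: e + v) & C (k *: e - v)].

Definition archimedean_cone C : Prop :=
  forall w v, C w -> (forall k : R, 0 < k -> C (k *: w + v)) -> C v.

Record order_unit_space C e : Prop := OrderUnitSpace {
  ous_cone : proper_cone C;
  ous_pos : C e;
  ous_neq0 : e <> 0;
  ous_unit : order_unit C e;
  ous_arch : archimedean_cone C }.

Definition ou_norm C e v : R :=
  inf [set k : R | [/\ 0 < k, C (k *: e + v) & C (k *: e - v)]].

Definition S_set C e : set V :=
  [set u | [/\ C u, ou_norm C e u = 1 & ou_norm C e (e - u) = 1]].

(* Order unit property; it is a property of positive elements only, hence the
   first conjunct. *)
Definition OUP C e u : Prop :=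
  C u /\
  forall v,
    (exists l : R, [/\ 0 < l, C (l *: u + v) & C (l *: u - v)]) ->
    C (ou_norm C e v *: u + v) /\ C (ou_norm C e v *: u - v).

Definition order_projection C e u : Prop := OUP C e u /\ OUP C e (e - u).

(* [nrm] is the norm of the ambient normed space. *)
Definition perp_infty (nrm : V -> R) x y : Prop :=
  forall k : R, nrm (x + k *: y) = Num.max (nrm x) (nrm (k *: y)).

Definition perp_infty_set (nrm : V -> R) A B : Prop :=
  forall a b, A a -> B b -> perp_infty nrm a b.

End OrderUnitSpace.

(* Main.v *)
Require Import Defs.
From mathcomp Require Import all_boot all_order all_algebra.
From mathcomp Require Import boolp classical_sets reals.
Import Order.TTheory GRing.Theory Num.Theory.
Local Open Scope classical_set_scope.
Local Open Scope ring_scope.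

(** Write [u' = e - u], so that [u + u' = e].  Every notion involved compares a
    vector [v] with a multiple [l u] of a positive element through
    [- l u <= v <= l u], here [dominates C u l v]: the norm of [v] is the least
    [l >= 0] with [dominates C e l v] (the infimum is attained because the cone
    is Archimedean), and the order unit property of [u] says that a [v]
    dominated by some multiple of [u] is dominated by [N(v) u].

    Let [u] be an order projection, [a] in [[-u, u]] and [b] a multiple of an
    element of [[-u', u']].  If [M] is the larger of [N(a)] and [N(b)], the
    order unit properties give [-M u <= a <= M u] and [-M u' <= b <= M u'];
    adding them yields [N(a + b) <= M].  The reverse inequality says that a
    bound [-t e <= a + b <= t e] splits into the bounds [-t u <= a <= t u] and
    [-t u' <= b <= t u'].  This is [OUP_component], where the order unit property
    is applied to [l u - a] rather than to [a].

    The orthogonality of the two intervals specializes to [u] and [u'], which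
    belong to them, as [perp_infty] is a symmetric relation.  Finally, if [v] is
    dominated by a multiple of [u] and [n = N(v) > 0], then the orthogonality of
    [u'] to the interval [[-u, u]] gives [N(u' + v / n) = 1], so
    [u' + v / n <= e], which is [v <= n u]; the same for [- v] gives the order
    unit property of [u].  The argument for [u'] is the same one, as [u] is
    [e - u']. *)

Definition dominates {R : realType} {V : lmodType R}
    (C : set V) (u : V) (l : R) (v : V) : Prop :=
  C (l *: u + v) /\ C (l *: u - v).

Section Domination.
Set Implicit Arguments.
Unset Strict Implicit.
Context {R : realType} {V : lmodType R} {C : set V}.
Hypothesis hC : proper_cone C.

Lemma dominatesN u l v : dominates C u l v -> dominates C u l (- v).
Proof. by case=> h1 h2; split; rewrite ?opprK //. Qed.

Lemma dominates0 u l : 0 <= l -> C u -> dominates C u l 0.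
Proof. by move=> l0 Cu; split; rewrite ?subr0 ?addr0; apply: cone_scale. Qed.

Lemma dominatesD u u' l v v' :
  dominates C u l v -> dominates C u' l v' -> dominates C (u + u') l (v + v').
Proof.
move=> [h1 h2] [h3 h4].
by split; rewrite scalerDr ?opprD addrACA; apply: cone_add.
Qed.

Lemma le_dominates u l l' v :
  C u -> l <= l' -> dominates C u l v -> dominates C u l' v.
Proof.
move=> Cu ll' [h1 h2].
have h : C ((l' - l) *: u) by apply: cone_scale; rewrite // subr_ge0.
by rewrite -(subrK l l'); split; rewrite scalerDl -addrA; apply: cone_add.
Qed.

Lemma dominatesZ u l v k :
  dominates C u l v -> dominates C u (`|k| * l) (k *: v).
Proof.
have pos k' : 0 <= k' -> dominates C u l v ->
    dominates C u (k' * l) (k' *: v).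
  move=> k0 [h1 h2]; split; rewrite -scalerA.
    by rewrite -scalerDr; apply: cone_scale.
  by rewrite -scalerBr; apply: cone_scale.
case: (ger0P k) => [k0|k0 h]; first exact: pos.
rewrite -[k *: v]opprK -scaleNr; apply: dominatesN.
by apply: pos; rewrite // oppr_ge0 ltW.
Qed.

Lemma order_intervalP u v : order_interval C (- u) u v <-> dominates C u 1 v.
Proof.
rewrite /order_interval /cone_le /dominates /= opprK scale1r [u + v]addrC.
by split.
Qed.

End Domination.

Section OrderUnitNorm.
Set Implicit Arguments.
Unset Strict Implicit.
Context {R : realType} {V : lmodType R} {C : set V} {e : V}.
Hypothesis hV : order_unit_space C e.

Local Notation N := (ou_norm C e).
Let hC := ous_cone hV.

Lemma ou_norm_ge0 v : 0 <= N v.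
Proof.
have [k hk] := ous_unit hV v.
by apply: lb_le_inf; [exists k | move=> x [/ltW]].
Qed.

Lemma ou_norm_le v t : 0 <= t -> dominates C e t v -> N v <= t.
Proof.
move=> t0 h; apply/ler_addgt0Pr => d d0; apply: ge_inf.
  by exists 0 => x [/ltW].
have [h1 h2] : dominates C e (t + d) v.
  by apply: le_dominates h; rewrite ?lerDl ?(ltW d0) //; apply: ous_pos hV.
by split; rewrite // ltr_wpDl.
Qed.

(** The infimum defining the norm is attained: each bound [N v + d] with
    [d > 0] dominates, and the Archimedean property lets [d] tend to [0]. *)
Lemma dominates_ou_norm v : dominates C e (N v) v.
Proof.
have h d : 0 < d -> dominates C e (N v + d) v.
  move=> d0; have hinf : has_inf
      [set k : R | [/\ 0 < k, C (k *: e + v) & C (k *: e - v)]].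
    by have [k hk] := ous_unit hV v; split; [exists k | exists 0 => x [/ltW]].
  have [k [_ h1 h2] kd] := inf_adherent d0 hinf.
  by apply: (le_dominates hC (ous_pos hV) (ltW kd)); split.
by split; apply: (ous_arch hV (ous_pos hV)) => d /h [h1 h2];
  rewrite addrA -scalerDl [d + _]addrC.
Qed.

Lemma dominates_of_ou_norm_le v t : N v <= t -> dominates C e t v.
Proof.
by move=> h; apply: le_dominates (dominates_ou_norm v) => //; apply: ous_pos hV.
Qed.

Lemma ou_norm0_eq0 v : N v = 0 -> v = 0.
Proof.
have [] := dominates_ou_norm v => h1 h2 n0; move: h1 h2.
by rewrite n0 scale0r add0r sub0r; apply: cone_proper.
Qed.

Lemma ou_normZ_le k v : N (k *: v) <= `|k| * N v.
Proof.
apply: ou_norm_le; first by rewrite mulr_ge0 // ou_norm_ge0.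
by apply: dominatesZ (dominates_ou_norm v).
Qed.

Lemma ou_normZ k v : N (k *: v) = `|k| * N v.
Proof.
apply/le_anti; rewrite ou_normZ_le /=.
have [->|k0] := eqVneq k 0; first by rewrite normr0 mul0r ou_norm_ge0.
rewrite -ler_pdivlMl ?normr_gt0 // -normfV.
by apply: le_trans (ou_normZ_le _ _); rewrite scalerK.
Qed.

Lemma perp_infty_sym x y : perp_infty N x y -> perp_infty N y x.
Proof.
move=> h k; have [->|k0] := eqVneq k 0.
  by rewrite scale0r addr0 -[0](scale0r y) ou_normZ normr0 mul0r max_l //
    ou_norm_ge0.
have -> : y + k *: x = k *: (x + k^-1 *: y).
  by rewrite scalerDr scalerKV // addrC.
by rewrite ou_normZ h maxr_pMr // -!ou_normZ scalerKV // maxC.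
Qed.

Lemma OUP_dominates u l v :
  OUP C e u -> 0 < l -> dominates C u l v -> dominates C u (N v) v.
Proof. by case=> _ h l0 [h1 h2]; apply: h; exists l. Qed.

(** A bound on [a + b] restricts to the component [a].  For the lower bound,
    [v = l u - a] is positive and at most [(l + t) e], since [l u' - b] and
    [t e + a + b] are positive and add up to [(l + t) e - v]; the order unit
    property improves this to [v <= (l + t) u], that is, [- t u <= a]. *)
Lemma OUP_component u u' l t a b :
  OUP C e u -> u + u' = e -> 0 < l -> 0 <= t ->
  dominates C u l a -> dominates C u' l b -> dominates C e t (a + b) ->
  dominates C u t a.
Proof.
move=> hu ue l0 t0.
have lower a' b' : dominates C u l a' -> dominates C u' l b' ->
    dominates C e t (a' + b') -> C (t *: u + a').
  move=> [ha1 ha2] [_ hb] [hab _].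
  set v := l *: u - a'.
  have lt0 : 0 <= l + t by rewrite addr_ge0 // ltW.
  have Nv : N v <= l + t.
    apply: ou_norm_le => //; split.
      by apply: cone_add => //; apply: cone_scale => //; apply: ous_pos hV.
    have -> : (l + t) *: e - v = (t *: e + (a' + b')) + (l *: u' - b').
      rewrite /v opprB scalerDl -{1}ue scalerDr [_ + t *: e]addrC.
      rewrite [l *: u + _]addrC [a' - _]addrC [l *: u' - _]addrC !addrA.
      by rewrite !addrK addrAC.
    exact: cone_add.
  have dv : dominates C u (l + l) v.
    have lu : C (l *: u) by apply: cone_scale => //; [apply: ltW | case: hu].
    split; rewrite scalerDl; first by do 2!apply: cone_add => //.
    by rewrite /v opprB addrC addrA subrK addrC.
  have := OUP_dominates hu (addr_gt0 l0 l0) dv.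
  move=> /(le_dominates hC hu.1 Nv) [_].
  by rewrite /v opprB scalerDl addrC addrA subrK addrC.
move=> ha hb hab; split; first exact: lower ha hb hab.
apply: (lower _ (- b)); try exact: dominatesN.
by rewrite -opprD; apply: dominatesN.
Qed.

Lemma ou_norm_component_le u u' l a b :
  OUP C e u -> C u' -> u + u' = e -> 0 < l ->
  dominates C u l a -> dominates C u' l b -> N a <= N (a + b).
Proof.
move=> hu Cu' ue l0 ha hb; have t0 := ou_norm_ge0 (a + b).
apply: ou_norm_le => //; rewrite -[X in dominates _ X]ue -[a in dominates _ _ _ a]addr0.
apply: dominatesD => //; last exact: dominates0.
by apply: OUP_component ha hb (dominates_ou_norm _).
Qed.

Lemma ou_normD_OUP u u' l a b :
  OUP C e u -> OUP C e u' -> u + u' = e -> 0 < l ->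
  dominates C u l a -> dominates C u' l b -> N (a + b) = Num.max (N a) (N b).
Proof.
move=> hu hu' ue l0 ha hb; have [Cu _] := hu; have [Cu' _] := hu'.
apply/le_anti/andP; split.
  apply: ou_norm_le; first by rewrite le_max ou_norm_ge0.
  rewrite -[X in dominates _ X]ue; apply: dominatesD => //.
    by apply: le_dominates (OUP_dominates hu l0 ha); rewrite // le_max lexx.
  by apply: le_dominates (OUP_dominates hu' l0 hb);
    rewrite // le_max lexx orbT.
rewrite ge_max (ou_norm_component_le hu Cu' ue l0 ha hb) /= addrC.
by apply: ou_norm_component_le hb ha; rewrite // addrC.
Qed.

(** With [n = N v], the orthogonality of [u'] to the multiples of [v] gives
    [N (u' + v / n) <= 1], whose upper half is [v / n <= e - u' = u]. *)
Lemma OUP_of_perp_infty u u' :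
  C u -> u + u' = e -> N u' = 1 ->
  perp_infty_set N [set u'] (order_interval C (- u) u) -> OUP C e u.
Proof.
move=> Cu ue Nu' perp; split=> // v [l [l0 hl1 hl2]].
have [n0|n0] := eqVneq (N v) 0.
  by rewrite n0 (ou_norm0_eq0 n0); apply: dominates0.
have n_gt0 : 0 < N v by rewrite lt_neqAle eq_sym n0 ou_norm_ge0.
have upper w : dominates C u l w -> N w = N v -> C (N v *: u - w).
  move=> hw nw.
  have iw : order_interval C (- u) u (l^-1 *: w).
    apply/order_intervalP; have := dominatesZ hC l^-1 hw.
    by rewrite normfV (gtr0_norm l0) mulVf // gt_eqF.
  (* The factor [l] undoes the scaling that brought [w] into the interval. *)
  have := perp u' _ erefl iw ((N v)^-1 * l).
  rewrite scalerA mulfK ?gt_eqF // Nu' ou_normZ nw normfV gtr0_norm //.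
  rewrite mulVf // maxxx => N1.
  have [_] : dominates C e 1 (u' + (N v)^-1 *: w).
    by apply: dominates_of_ou_norm_le; rewrite N1.
  rewrite scale1r -{1}ue opprD addrA addrK => /(cone_scale hC (ltW n_gt0)).
  by rewrite scalerBr scalerKV.
split; last by apply: upper; first split.
have := upper (- v); rewrite opprK; apply.
  by apply: dominatesN; split.
by rewrite -scaleN1r ou_normZ normrN1 mul1r.
Qed.

End OrderUnitNorm.

Theorem corollary1p4 (R : realType) (V : lmodType R) (C : set V) (e : V)
    (hV : order_unit_space C e) (u : V) (hu : S_set C e u) :
  [<-> order_projection C e u;
       perp_infty_set (ou_norm C e)
         (order_interval C (- u) u) (order_interval C (- (e - u)) (e - u));
       perp_infty_set (ou_norm C e)
         [set u] (order_interval C (- (e - u)) (e - u)) /\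
       perp_infty_set (ou_norm C e)
         [set (e - u)] (order_interval C (- u) u)].
Proof.
have hC := ous_cone hV; have [Cu Nu Nu'] := hu.
have ue : u + (e - u) = e by rewrite addrC subrK.
have Cu' : C (e - u).
  have [_] := dominates_ou_norm hV u.
  by rewrite Nu scale1r.
have self w : C w -> order_interval C (- w) w w.
  move=> Cw; apply/order_intervalP; rewrite /dominates scale1r subrr.
  by split; [apply: cone_add | apply: cone_zero].
tfae.
- move=> [hu1 hu2] a b /order_intervalP ha /order_intervalP hb k.
  have l0 : 0 < 1 + `|k| by rewrite ltr_wpDr.
  apply: (ou_normD_OUP hV hu1 hu2 ue l0).
    by apply: le_dominates ha; rewrite // lerDl.
  apply: le_dominates (dominatesZ hC k hb) => //.
  by rewrite mulr1 lerDr.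
- move=> perp; split=> a b -> hb; first exact/perp/hb/self.
  by apply: (perp_infty_sym hV); apply: perp => //; apply: self.
- move=> [perp perp']; split.
    exact: (OUP_of_perp_infty hV Cu ue Nu' perp').
  by apply: (OUP_of_perp_infty hV Cu' _ Nu perp); rewrite subrK.
Qed.
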